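(* Let $P\in\mathcal{P}$. If $M(q)$ is odd and $K(q)\ge \frac{M(q)}{3}$ for some $q\in Q$, then $P$ has two disjoint induced paths which together span $P$ (i.e. the vertex set of $P$ can be partitioned into two subsets each of which induces a path in $P$).
   Context: Graphs are finite and loopless but may have multiple edges. A plane triangulation is a plane graph all of whose faces (including the outer one) are bounded by cycles of length 3. $\mathcal{P}$ is the family of all 2-connected plane triangulations all of whose vertices have degree 3 or 6. $Q=\{0,1,2\}$ is the cyclic group of integers modulo 3. For $P\in\mathcal{P}$ fix a partition of the edge set into three classes indexed by $Q$ such that for every vertex $v$, if two edges are counterclockwise successive edges incident with $v$, then the first is of class $q$ and the second is of class $q+1$ for some $q\in Q$ (such a partition is known to exist, by Grünbaum and Motzkin). It is known that the spanning subgraph $P_q$ formed by the edges of class $q$ consists of two induced paths (the maximal paths of class $q$, whose ends are the four vertices of degree 3) of the same length, denoted $M(q)$, and of $K(q)-1$ induced cycles of the same length $2M(q)$, where $K(q)$ is the distance in $P$ between the two maximal paths of class $q$. *)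

(* Defs.v *)
From HB Require Import structures.
From mathcomp Require Import all_boot all_order all_fingroup all_algebra.

Set Implicit Arguments.
Unset Strict Implicit.
Unset Printing Implicit Defensive.

(* An embedded multigraph on an oriented closed surface is
   encoded by its rotation system: a dart is an edge together with one of its
   two directions, [opp] reverses a dart, and [rot] sends a dart to the
   counterclockwise next dart with the same tail. *)
Record cmap := CMap {
  dart :> finType;
  opp : {perm dart};
  rot : {perm dart};
  opp_invol : forall d, opp (opp d) = d;
  opp_free : forall d, opp d != d
}.

Section Maps.
Variable P : cmap.
Implicit Types (d : P) (p : seq P) (F : pred P).
Implicit Types (u v : {set P}) (S A B : {set {set P}}).

(* A vertex is the set of the darts leaving it, hence its degree is its
   cardinality. *)
Definition vertices : {set {set P}} := porbits (rot P).
Definition tail d : {set P} := porbit (rot P) d.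
Definition head d : {set P} := tail (opp P d).

(* [facial d] is the dart following [d] along the face to the left of [d]:
   reverse [d], then turn clockwise. *)
Definition facial : {perm P} := (opp P * (rot P)^-1)%g.

(* Adjacency in the spanning subgraph whose edges satisfy [F]. *)
Definition adj F : rel {set P} :=
  [rel u v | [exists d, [&& F d, tail d == u & head d == v]]].

Definition connected_on S : Prop :=
  {in S &, forall u v,
     connect [rel x y | [&& x \in S, y \in S & adj predT x y]] u v}.

Definition loopless : Prop := forall d, tail d != head d.

Definition two_connected : Prop :=
  [/\ 2 < #|vertices|, connected_on vertices
    & forall v, v \in vertices -> connected_on (vertices :\ v)].

(* Euler's formula; it characterises planarity for connected maps. *)
Definition planar : Prop :=
  #|vertices| + #|porbits facial| = #|porbits (opp P)| + 2.

(* In a loopless map a facial orbit of length 3 visits three distinct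
   vertices, i.e. it is a cycle. *)
Definition triangulated : Prop := forall d, #|porbit facial d| = 3.

Definition calP : Prop :=
  [/\ loopless, two_connected, planar, triangulated
    & forall v, v \in vertices -> #|v| = 3 \/ #|v| = 6].

Definition edge_classes (c : P -> 'Z_3) : Prop :=
  (forall d, c (opp P d) = c d) /\ (forall d, c (rot P d) = (c d + 1)%R).

(* The graph with vertex set [S], whose edges are all edges satisfying [F]
   with both ends in [S], is a path with [n] edges (n = 0 is a single vertex);
   parallel edges are excluded.  The path starts at [u] and follows the
   darts [p]. *)
Definition is_path F S (n : nat) : Prop :=
  exists u p,
    [/\ u \in vertices,
        map tail p = belast u (map head p),
        uniq (u :: map head p),
        S = [set v in u :: map head p]
      & size p = n] /\
    (forall d, tail d \in S -> head d \in S ->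
       F d <-> d \in p \/ opp P d \in p).

Definition induces_path S : Prop := exists n, is_path predT S n.

Definition set_dist A B (k : nat) : Prop :=
  (exists u s, [/\ u \in A, path (adj predT) u s, last u s \in B & size s = k])
  /\ (forall u s, u \in A -> path (adj predT) u s -> last u s \in B ->
        k <= size s).

(* A maximal path of class q: a connected component of the spanning subgraph
   of class q that is a path and not a cycle. *)
Definition maximal_path (c : P -> 'Z_3) (q : 'Z_3) A (n : nat) : Prop :=
  (exists2 u, u \in vertices &
     A = [set v in vertices | connect (adj [pred d | c d == q]) u v])
  /\ is_path [pred d | c d == q] A n.

(* M = M(q), the common length of the two maximal paths of class q, and
   K = K(q), the distance between them in the whole graph. *)
Definition class_MK (c : P -> 'Z_3) (q : 'Z_3) (M K : nat) : Prop :=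
  exists A B,
    [/\ A != B, maximal_path c q A M, maximal_path c q B M & set_dist A B K].

End Maps.

(* Main.v *)
Require Import Defs.
From HB Require Import structures.
From mathcomp Require Import all_boot all_order all_fingroup all_algebra.
From mathcomp Require Import zify.

(** Put [R := rot^3], the half turn about the tail of a dart, and let [X] push a
dart straight ahead along its edge.  At a vertex of degree 3 we have [R d = d],
so that [X] turns back there.  Faces being triangles, [X] commutes with its
conjugate [Y] under [rot], and [R] inverts both; hence the darts of class [q],
based at an end [b] of the path [A], form a quotient of Z^2 by a lattice Lambda,
and vertices are the pairs [{x, -x}] of that quotient.  The two maximal paths of
class [q] show that Lambda is spanned by [(2M, 0)] and [(2a, 2J)], where
[K <= J] because the walk [b, Y b, ..., Y^J b] joins the two paths.

For [0 <= t <= J] there is an odd function [f : Z -> Z] with steps 0 and -1 and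
[f (n + 2J) = f n - 2t].  The points [(f n, n)] project to a path folded at
both ends, which has [JM] edges if [a + t] is coprime to [M], and the points
[(f n + M, n)] to a disjoint one.  In every row parities alternate between the
two paths ([M] is odd), whence both are induced.  A suitable [t] exists
because the residues [+-2^j] and [(M-1)/2], all coprime to [M], meet every
window of [K+1 >= M/3 + 1] consecutive integers. *)

Set Implicit Arguments.
Unset Strict Implicit.
Unset Printing Implicit Defensive.

Import Defs GRing.Theory Num.Theory.

(** * Integers coprime to an odd number in short windows *)

Lemma coprime_half M : odd M -> coprime M./2 M.
Proof.
move=> oM; rewrite -{2}(odd_double_half M) oM -muln2 mulnC addnC.
by rewrite /coprime gcdnMDl gcdn1.
Qed.

Lemma coprime_pow2 j M : odd M -> coprime (2 ^ j) M.
Proof. by move=> oM; case: j => [|j]; rewrite ?coprime1n // coprime_pexpl // coprime2n. Qed.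

Lemma pow2_floor b : 0 < b -> exists j, 2 ^ j <= b < 2 ^ j.+1.
Proof. by move=> b0; exists (trunc_log 2 b); apply: trunc_log_bounds. Qed.

(** For [0 < a <= M./2] the target is [M./2] if the window reaches it; otherwise [2 * a < J], and
    the least power of two above [a], being at most [2 * a], is near enough. For larger [a] the
    target is [M] minus the greatest power of two not exceeding [M - a]. *)
Lemma coprime_in_window_nat (a M J : nat) :
  odd M -> M <= 3 * J -> a < M -> exists2 t, t <= J & coprime (a + t) M.
Proof.
move=> oM MJ aM.
have [->|a0] := posnP a.
  by exists 1; rewrite ?add0n ?coprime1n //; lia.
have [aH|Ha] := leqP a M./2.
  have [a6|a6] := leqP (M./2) (a + J).
    exists (M./2 - a); first lia.
    by rewrite subnKC // coprime_half.
  have [j /andP[j1 j2]] := pow2_floor a0.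
  exists (2 ^ j.+1 - a); first by rewrite expnS in j2 *; lia.
  by rewrite subnKC ?coprime_pow2 // ltnW.
have b0 : 0 < M - a by lia.
have [j /andP[j1 j2]] := pow2_floor b0.
exists (M - a - 2 ^ j); first by rewrite expnS in j2; lia.
have -> : a + (M - a - 2 ^ j) = M - 2 ^ j by lia.
have pM : 2 ^ j <= M by lia.
by rewrite /coprime -{2}(subnK pM) gcdnDl gcdnC -gcdnDl subnKC //; apply: coprime_pow2.
Qed.

Lemma coprime_in_window (a : int) (M J : nat) :
  odd M -> M <= 3 * J -> exists2 t : nat, t <= J & coprimez (a + t%:Z)%R M.
Proof.
move=> oM MJ.
have M0 : (M%:Z != 0)%R by case: M oM {MJ}.
have aM : (`|(a %% M)%Z| < M)%N.
  by rewrite -ltz_nat gez0_abs ?modz_ge0 // ltz_pmod //; case: M oM {MJ M0}.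
have [t tJ ct] := coprime_in_window_nat oM MJ aM.
exists t => //.
move: ct; rewrite /coprimez.
rewrite -gcdz_modl -modzDml gcdz_modl /gcdz /coprime.
have -> : ((a %% M)%Z + t = (`|(a %% M)%Z| + t)%N%:Z)%R by rewrite PoszD gez0_abs ?modz_ge0.
by rewrite !absz_nat => /eqP ->.
Qed.

(** * Integer powers in a finite group *)

Section IntegerPowers.
Import GroupScope.
Variables (gT : finGroupType).
Implicit Types (x y : gT) (m n : int).

Definition zpow x m := match m with Posz k => x ^+ k | Negz k => x ^- k.+1 end.

Lemma zpowS x m : zpow x (m + 1)%R = zpow x m * x.
Proof.
case: m => [k|[|k]]; first by rewrite /= addn1 expgSr.
  by rewrite /= mulVg.
have -> : (Negz k.+1 + 1 = Negz k)%R by lia.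
by rewrite /= [in RHS]expgS invMg -mulgA mulVg mulg1.
Qed.

Lemma zpowD x m n : zpow x (m + n)%R = zpow x m * zpow x n.
Proof.
have posD m' k : zpow x (m' + k%:Z)%R = zpow x m' * x ^+ k.
  elim: k => [|k IHk]; first by rewrite addr0 expg0 mulg1.
  by rewrite -addn1 PoszD addrA zpowS IHk addn1 expgSr mulgA.
case: n => [k|k]; first exact: posD.
apply: (mulIg (x ^+ k.+1)); rewrite -posD -mulgA mulVg mulg1.
by congr zpow; lia.
Qed.

Lemma zpowN x m : zpow x (- m)%R = (zpow x m)^-1.
Proof. by apply/eqP; rewrite eq_sym eq_invg_mul -zpowD subrr. Qed.

Lemma zpow_commute x y m : commute x y -> commute (zpow x m) y.
Proof.
move=> xy; case: m => k /=; apply: commute_sym; first exact/commuteX/commute_sym.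
exact/commuteV/commuteX/commute_sym.
Qed.

Lemma zpowJ x y m : zpow (x ^ y) m = zpow x m ^ y.
Proof. by case: m => k; rewrite /= ?conjVg conjXg. Qed.

Lemma zpowV x m : zpow x^-1 m = (zpow x m)^-1.
Proof. by case: m => k; rewrite /= expgVn. Qed.

End IntegerPowers.

(** * Commuting translations from the relations of the triangular lattice *)

Section Translations.
Import GroupScope.
Variable (gT : finGroupType) (o r : gT).
Hypotheses (oo : o * o = 1) (r6 : r ^+ 6 = 1) (face : (o * r^-1) ^+ 3 = 1).

Let R := r ^+ 3.
Let X := o * R.
Let Y := r * o * r ^+ 2.

Lemma half_turnK : R * R = 1. Proof. by rewrite -expgD. Qed.
Lemma half_turnV : R^-1 = R. Proof. by apply/eqP; rewrite eq_invg_mul half_turnK. Qed.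

Lemma flipV : o^-1 = o. Proof. by apply/eqP; rewrite eq_invg_mul oo. Qed.

Lemma face_rel : o * r^-1 * o = r * o * r.
Proof.
have := face; rewrite !expgS expg0 mulg1 => e.
apply: (mulIg (r^-1 * (o * r^-1))).
by rewrite -[LHS]mulgA mulgA -!mulgA !mulgA in e *; rewrite e mulgK -(mulgA r) oo mulg1 mulgV.
Qed.

Lemma YE : Y = r * X * r^-1.
Proof. by rewrite /Y /X /R !mulgA mulgK. Qed.

(** In the triangular lattice the unit vector at 120 degrees is the difference of those at 60 and 0
    degrees. Products are to be read from left to right: turn twice, move, turn back. *)
Lemma X_rot2 : r ^+ 2 * X * r ^- 2 = X^-1 * Y.
Proof.
apply: (mulgI X); rewrite mulKVg /Y /X /R.
have r5 : r ^+ 3 * r ^+ 2 = r^-1.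
  by apply/eqP; rewrite eq_sym eq_invg_mul -expgD -expgS r6.
have e : o * r ^+ 3 * (r ^+ 2 * (o * r ^+ 3) * r ^- 2) = o * (r ^+ 3 * r ^+ 2) * o * r.
  by rewrite !mulgA invMg !mulgA !mulgK.
by rewrite e r5 face_rel !mulgA.
Qed.

(** A second use of [face_rel] shows that [r ^+ 2 * X * r ^- 2 * X] is [Y]; by [X_rot2] it is also
    [X^-1 * Y * X]. *)
Lemma XY_commute : commute X Y.
Proof.
have e : r ^+ 2 * X * r ^- 2 * X = r * (r * o * r) * o * r ^+ 3.
  by rewrite /X /R !mulgA invMg !mulgA !mulgK.
move: e; rewrite -face_rel X_rot2 -!mulgA (mulgA o o) oo mul1g.
have -> : r * (o * (r^-1 * r ^+ 3)) = Y by rewrite /Y !mulgA mulgKV.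
rewrite -/X => e; rewrite /commute -{1}e mulKVg /Y -!mulgA; apply: erefl.
Qed.

Lemma XV : X^-1 = X ^ R.
Proof. by rewrite /X invMg flipV half_turnV /conjg half_turnV -(mulgA o) half_turnK mulg1. Qed.

Lemma YV : Y^-1 = Y ^ R.
Proof.
have rR : commute r^-1 R by apply/commute_sym/commuteV/commute_sym/commuteX.
have -> : Y = X ^ r^-1 by rewrite YE /conjg invgK -(mulgA r X).
by rewrite -conjgM rR conjgM -XV conjVg.
Qed.

Definition trans (i j : int) := zpow X i * zpow Y j.

Lemma transD i1 j1 i2 j2 : trans (i1 + i2)%R (j1 + j2)%R = trans i1 j1 * trans i2 j2.
Proof.
rewrite /trans !zpowD -!mulgA; congr (_ * _); rewrite !mulgA; congr (_ * _).
by apply/zpow_commute/commute_sym/zpow_commute/commute_sym/XY_commute.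
Qed.

Lemma trans0 : trans 0%R 0%R = 1. Proof. exact: mulg1. Qed.
Lemma trans10 : trans 1%R 0%R = X. Proof. exact: mulg1. Qed.
Lemma trans01 : trans 0%R 1%R = Y. Proof. exact: mul1g. Qed.

Lemma transN i j : trans (- i)%R (- j)%R = trans i j ^ R.
Proof. by rewrite /trans conjMg -!zpowJ -XV -YV !zpowV !zpowN. Qed.

End Translations.

(** * Translations acting on darts, vertices and classes *)

Section Darts.
Variables (P : cmap) (c : P -> 'Z_3).
Hypothesis deg36 : forall v, v \in vertices P -> #|v| = 3 \/ #|v| = 6.
Hypothesis tri : triangulated P.
Hypothesis hc : edge_classes c.
Implicit Types (d e z : P) (i j : int).

Local Notation R := (rot P ^+ 3)%g.
Local Notation X := (opp P * (rot P ^+ 3))%g.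
Local Notation Y := (rot P * opp P * rot P ^+ 2)%g.
Local Notation T i j := (trans (opp P) (rot P) i%R j%R).

Lemma opp_mul : (opp P * opp P = 1)%g.
Proof. by apply/permP => d; rewrite permM perm1 opp_invol. Qed.

Lemma rot_order6 : (rot P ^+ 6 = 1)%g.
Proof.
apply/permP => d; rewrite permX perm1.
have /deg36 : porbit (rot P) d \in vertices P by apply: imset_f.
have := iter_porbit (rot P) d.
by case=> + [] => /[swap] -> // e; rewrite -[6]/(3 + 3) iterD !e.
Qed.

Lemma facial_order3 : ((opp P * (rot P)^-1) ^+ 3 = 1)%g.
Proof.
apply/permP => d; rewrite permX perm1.
by have := iter_porbit (facial P) d; rewrite tri.
Qed.

Lemma tail_in_vertices d : tail d \in vertices P.
Proof. exact: imset_f. Qed.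

Lemma vertexP v : v \in vertices P -> exists d, v = tail d.
Proof. by case/imsetP => d _ ->; exists d. Qed.

Lemma tail_rotX k d : tail ((rot P ^+ k)%g d) = tail d.
Proof. by apply/eqP; rewrite eq_porbit_mem mem_porbit. Qed.

Lemma tail_rot d : tail (rot P d) = tail d.
Proof. exact: (tail_rotX 1). Qed.

Lemma tail_eqP d e : tail d = tail e -> exists k, d = (rot P ^+ k)%g e.
Proof. by move/eqP; rewrite eq_porbit_mem => /porbitP. Qed.

Lemma half_turn_invol d : R (R d) = d.
Proof. by rewrite -permM -expgD rot_order6 perm1. Qed.

Lemma tail_dart_cases d z : tail d = tail z -> exists2 z', z' = z \/ z' = R z &
  [\/ d = z', d = rot P z' | d = rot P (rot P z')].
Proof.
case/tail_eqP => k ->.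
have -> : (rot P ^+ k)%g z = (rot P ^+ (k %% 3))%g (iter (k %/ 3) R z).
  by rewrite {1}(divn_eq k 3) expgD mulnC expgM permM (permX R).
exists (iter (k %/ 3) R z).
  elim: (k %/ 3) => [|n [] IHn] /=; [by left | right | left]; rewrite IHn //.
  exact: half_turn_invol.
have : k %% 3 < 3 by rewrite ltn_mod.
case: (k %% 3) => [|[|[|//]]] _; rewrite ?expg0 ?perm1 ?expg1; first by constructor 1.
  by constructor 2.
by constructor 3; rewrite permX.
Qed.

Lemma class_rotX k d : c ((rot P ^+ k)%g d) = (c d + k%:R)%R.
Proof.
elim: k => [|k IHk]; first by rewrite expg0 perm1 addr0.
by rewrite expgSr permM hc.2 IHk mulrSr addrA.
Qed.

Lemma class_half_turn d : c (R d) = c d.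
Proof. by rewrite class_rotX (_ : 3%:R = 0)%R ?addr0 //; apply/val_inj. Qed.

(** One rotation adds 1 to the class modulo 3, so darts of one class at a vertex differ by a
    multiple of three rotations. Vertices thus become pairs [{d, R d}] within a fixed class. *)
Lemma tail_class_eq d e : tail d = tail e -> c d = c e -> d = e \/ d = R e.
Proof.
move=> /tail_dart_cases[z' hz'] hd cd.
have cz : c z' = c e by case: hz' => ->; rewrite ?class_half_turn.
case: hd => dE.
- by rewrite dE.
- by move/eqP: cd; rewrite dE hc.2 cz -subr_eq0 addrAC subrr.
- by move/eqP: cd; rewrite dE !hc.2 cz -addrA -subr_eq0 addrAC subrr.
Qed.

Lemma head_tail_trans10 d : head d = tail (T 1 0 d).
Proof. by rewrite trans10 (permM (opp P)) tail_rotX. Qed.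

Lemma head_rot d : head (rot P d) = tail (T 0 1 d).
Proof. by rewrite trans01 (permM (rot P * _)%g) tail_rotX permM. Qed.

Lemma transD_act i1 j1 i2 j2 d : T i2 j2 (T i1 j1 d) = T (i1 + i2) (j1 + j2) d.
Proof. by rewrite (transD opp_mul rot_order6 facial_order3) [RHS]permM. Qed.

Lemma trans0_act d : T 0 0 d = d.
Proof. by rewrite trans0 perm1. Qed.

Lemma transN_act i j d : T (- i) (- j) (R d) = R (T i j d).
Proof.
by rewrite (transN opp_mul rot_order6) permJ.
Qed.

Lemma trans_diag d : T (-1) 1 d = (rot P ^+ 4)%g (R (opp P (rot P (rot P d)))).
Proof.
have r4 : ((rot P ^+ 2)^-1 = rot P ^+ 4)%g.
  by apply/eqP; rewrite eq_invg_mul -expgD rot_order6.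
have e : T (-1) 1 = (rot P ^+ 2 * X * rot P ^+ 4)%g.
  by rewrite -r4 (X_rot2 opp_mul rot_order6 facial_order3).
rewrite e (permM (rot P ^+ 2 * X)%g) (permM (rot P ^+ 2)%g) (permM (opp P)).
by rewrite (permX (rot P) d 2).
Qed.

Lemma head_rot2 d : head (rot P (rot P d)) = tail (T (-1) 1 d).
Proof. by rewrite trans_diag !tail_rotX. Qed.

Lemma opp_trans d : opp P d = R (T 1 0 d).
Proof. by rewrite trans10 (permM (opp P)) half_turn_invol. Qed.

Lemma rot_iter6 d : iter 6 (rot P) d = d.
Proof. by rewrite -permX rot_order6 perm1. Qed.

Lemma opp_rot_trans d : opp P (rot P d) = rot P (R (T 0 1 d)).
Proof.
rewrite trans01 (permM (rot P * _)%g) !permX permM.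
exact/esym/rot_iter6.
Qed.

Lemma opp_rot2_trans d : opp P (rot P (rot P d)) = rot P (rot P (R (T (-1) 1 d))).
Proof.
rewrite trans_diag !permX -[LHS]rot_iter6 -[LHS]rot_iter6.
by [].
Qed.

Lemma class_translate i j d : c (T i j d) = c d.
Proof.
have cX e : c (X e) = c e by rewrite (permM (opp P)) class_half_turn hc.1.
have cY e : c (Y e) = c e.
  rewrite (permM (rot P * _)%g) class_rotX permM hc.1 hc.2 -addrA.
  by rewrite (_ : 1 + 2%:R = 0)%R ?addr0 //; apply/val_inj.
have cZ (s : {perm P}) (k : int) e : (forall e, c (s e) = c e) -> c (zpow s k e) = c e.
  move=> cs; have cn n e' : c ((s ^+ n)%g e') = c e'.
    by elim: n => [|n IHn]; rewrite ?expg0 ?perm1 // expgSr permM cs.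
  case: k => n /=; first exact: cn.
  by rewrite -[in RHS](permKV (s ^+ n.+1)%g e) cn.
by rewrite permM !cZ.
Qed.

(** Since [R b = b], the half turn negates the coordinates of [T i j b]. Along a walk from [tail b],
    each edge adds [(1, 0)], [(0, 1)] or [(-1, 1)] to the coordinates, possibly after such a
    negation. *)
Lemma dart_of_class b d : R b = b -> connected_on (vertices P) -> c d = c b ->
  exists i j, d = T i j b.
Proof.
move=> Rb conn cd.
have RT i j : R (T i j b) = T (- i) (- j) b by rewrite -transN_act Rb.
suff [i [j tj]] : exists i j, tail d = tail (T i j b).
  have [|->|->] := tail_class_eq tj; first by rewrite class_translate.
    by exists i, j.
  by exists (- i)%R, (- j)%R.
have [p + ->] := connectP (conn _ _ (tail_in_vertices b) (tail_in_vertices d)).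
have : exists i j, tail b = tail (T i j b) by exists 0%R, 0%R; rewrite trans0_act.
elim: p (tail b) => [|v p IHp] u //= [i [j ->]] /andP[/and3P[_ _ /existsP[e]]].
case/and3P=> _ /eqP te /eqP <- pp; apply: IHp pp.
have {te} [z hz he] := tail_dart_cases te.
have {hz} [i' [j' zE]] : exists i' j', z = T i' j' b.
  by case: hz => ->; [exists i, j | exists (- i)%R, (- j)%R].
case: he => ->; rewrite ?head_rot2 ?head_rot ?head_tail_trans10 zE transD_act;
  by do 2 eexists.
Qed.

End Darts.

(** * The staircase function that shapes the paths *)

Section Shift.
Local Open Scope ring_scope.

Lemma shift_exists (J t : nat) : (0 < J)%N -> (t <= J)%N ->
  exists f : int -> int,
    [/\ forall n, f (- n) = - f n,
        forall n k, f (n + 2 * J%:Z * k) = f n - 2 * t%:Z * k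
      & forall n, f (n + 1) = f n \/ f (n + 1) = f n - 1].
Proof.
move=> J0 tJ.
(* On row [2 J k + m] with [|m| <= J] the shift is [- (2 t k + clamp m)]; the two
   representations of a row available for [m = J] and [m = - J] agree. *)
pose clamp (m : int) := if m <= - t%:Z then - t%:Z else if m <= t then m else t%:Z.
pose f (n : int) := let k := ((n + J) %/ (2 * J%:Z))%Z in
  - (2 * t%:Z * k + clamp (n - 2 * J%:Z * k)).
have fE k m : - J%:Z <= m <= J -> f (2 * J%:Z * k + m) = - (2 * t%:Z * k + clamp m).
  move=> hm; rewrite /f.
  have := divz_eq (2 * J%:Z * k + m + J) (2 * J%:Z).
  have : 0 <= ((2 * J%:Z * k + m + J) %% (2 * J%:Z))%Z by apply: modz_ge0; lia.
  have : ((2 * J%:Z * k + m + J) %% (2 * J%:Z))%Z < 2 * J%:Z by apply: ltz_pmod; lia.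
  move: (_ %/ _)%Z (_ %% _)%Z => q r rJ r0 e.
  have [qk|qk] : q = k \/ q = k + 1 by nia.
    by rewrite qk; congr (- (_ + clamp _)); lia.
  have -> : 2 * J%:Z * k + m - 2 * J%:Z * q = - J%:Z by rewrite qk; nia.
  have -> : m = J by nia.
  by rewrite qk /clamp; do ?[case: ifP => ?]; nia.
have nE n : exists k m, n = 2 * J%:Z * k + m /\ - J%:Z <= m < J.
  exists ((n + J) %/ (2 * J%:Z))%Z, (((n + J) %% (2 * J%:Z))%Z - J%:Z).
  have := divz_eq (n + J) (2 * J%:Z).
  have : 0 <= ((n + J) %% (2 * J%:Z))%Z by apply: modz_ge0; lia.
  have : ((n + J) %% (2 * J%:Z))%Z < 2 * J%:Z by apply: ltz_pmod; lia.
  by move: (_ %/ _)%Z (_ %% _)%Z => q r; lia.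
exists f; split=> [n|n k|n]; have [k' [m [-> hm]]] := nE n.
- have -> : - (2 * J%:Z * k' + m) = 2 * J%:Z * (- k') + (- m) by lia.
  by rewrite !fE /clamp; [do ?[case: ifP => ?]; lia | lia | lia].
- have -> : 2 * J%:Z * k' + m + 2 * J%:Z * k = 2 * J%:Z * (k' + k) + m by lia.
  by rewrite !fE; lia.
- rewrite -addrA !fE; try lia.
  by rewrite /clamp; do ?[case: ifP => ?]; lia.
Qed.

End Shift.

Lemma mkseq_shift (T : Type) (g : nat -> T) n :
  g 0 :: mkseq (fun i => g i.+1) n = mkseq g n.+1.
Proof.
rewrite /mkseq /= -[iota 1 n]/(iota (1 + 0) n) iotaDl -map_comp.
by congr cons; apply: eq_map.
Qed.

Lemma belast_mkseq (T : Type) (g : nat -> T) n :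
  belast (g 0) (mkseq (fun i => g i.+1) n) = mkseq g n.
Proof.
elim: n g => [|n IHn] g //.
by rewrite -(mkseq_shift (fun i => g i.+1)) /= (IHn (fun i => g i.+1)) mkseq_shift.
Qed.

(** * The folded path over the staircase and its shifted companion *)

Section Strand.
Variables (P : cmap) (c : P -> 'Z_3).
Hypothesis deg36 : forall v, v \in vertices P -> #|v| = 3 \/ #|v| = 6.
Hypothesis tri : triangulated P.
Hypothesis hc : edge_classes c.

Local Notation R := (rot P ^+ 3)%g.
Local Notation T i j := (trans (opp P) (rot P) i%R j%R).

Variables (J M t : nat) (a : int) (f : int -> int).
Hypotheses (J_gt0 : (0 < J)%N) (oddM : odd M).
Hypothesis coprime_at : coprimez (a + t%:Z)%R M.
Local Open Scope ring_scope.

Hypothesis fN : forall n, f (- n) = - f n.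
Hypothesis fD : forall n k, f (n + 2 * J%:Z * k) = f n - 2 * t%:Z * k.
Hypothesis fS : forall n, f (n + 1) = f n \/ f (n + 1) = f n - 1.

Definition lattice_at b := forall x y : int, T x y b = b <->
  exists k l : int, y = 2 * J%:Z * k /\ x = 2 * a * k + 2 * M%:Z * l.

Let rotD := transD_act deg36 tri.
Let rotN := transN_act deg36.

Let T_congr i j i' j' d : i = i' -> j = j' -> T i j d = T i' j' d.
Proof. by move=> -> ->. Qed.

Section Base.
Variable b : P.
Hypotheses (Rb : R b = b) (latb : lattice_at b).

Definition strand (n : int) : P := T (f n) n b.
Local Notation w := strand.

Definition strand_dart (n : int) : P :=
  if f (n + 1) == f n then rot P (w n) else rot P (rot P (w n)).
Local Notation e := strand_dart.

Lemma trans_inj x y x' y' : T x y b = T x' y' b -> exists k l : int,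
  y - y' = 2 * J%:Z * k /\ x - x' = 2 * a * k + 2 * M%:Z * l.
Proof.
move=> E; apply/latb.
have -> : T (x - x') (y - y') b = T (- x') (- y') (T x y b) by rewrite rotD.
by rewrite E rotD !subrr trans0_act.
Qed.

Lemma trans_eq x y x' y' k l :
  y - y' = 2 * J%:Z * k -> x - x' = 2 * a * k + 2 * M%:Z * l -> T x y b = T x' y' b.
Proof.
move=> ey ex.
have -> : T x y b = T (x - x' + x') (y - y' + y') b by apply: T_congr; lia.
by rewrite -rotD; congr (fun_of_perm _ _); apply/latb; exists k, l.
Qed.

(** Because [f] is odd, rows [n] and [- n] of the strand give the same vertex: the strand is folded
    at row 0. *)
Lemma strandN n : w (- n) = R (w n).
Proof. by rewrite /w fN -rotN Rb. Qed.

Lemma strand_class n : c (w n) = c b.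
Proof. by rewrite class_translate. Qed.

Lemma strand_tail d n : c d = c b -> tail d = tail (w n) ->
  exists m, d = w m.
Proof.
move=> cd td; have [|->|->] := tail_class_eq deg36 hc td.
- by rewrite cd strand_class.
- by exists n.
- by exists (- n); rewrite strandN.
Qed.

Lemma strand_tail_eq n m : tail (w n) = tail (w m) -> w n = w m \/ w n = w (- m).
Proof. by move=> tnm; rewrite strandN; apply: (tail_class_eq deg36 hc); rewrite ?strand_class. Qed.

(** All horizontal displacements are even: Lambda contributes [2 * a] and [2 * M], and [f] changes
    by [2 * t] per [2 * J] rows. This parity obstruction yields both inducedness and
    disjointness. *)
Lemma strand_parity s n m : T s 0 (w n) = w m -> exists h, s = 2 * h.
Proof.
rewrite rotD => /trans_inj[k [l [ey ex]]].
have fnm : f n = f m - 2 * t%:Z * k by rewrite -fD; congr f; lia.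
exists (t%:Z * k + a * k + M%:Z * l); lia.
Qed.

(** Comparing coordinates gives [n - m = 2 * J * k] and [(a + t) * k = - M * l], so by coprimality
    [M] divides [k]; the Bezout coefficients provide the quotient [v * k - u * l]. *)
Lemma strand_inj n m : w n = w m -> exists k, n - m = 2 * (J * M)%N%:Z * k.
Proof.
case/trans_inj=> k [l [ey ex]].
have fnm : f n = f m - 2 * t%:Z * k by rewrite -fD; congr f; lia.
have [[u v] /= uv] := coprimezP _ _ coprime_at.
have dk : (a + t) * k = - M%:Z * l by lia.
exists (v * k - u * l); rewrite ey PoszM -!mulrA; do 2 congr (_ * _).
rewrite -[LHS]mul1r -uv.
have -> : (u * (a + t) + v * M) * k = u * ((a + t) * k) + v * M * k by lia.
by rewrite dk; lia.
Qed.

Lemma shift_period n k : f (n + 2 * (J * M)%N%:Z * k) = f n - 2 * t%:Z * (M%:Z * k).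
Proof. by rewrite -fD; congr f; lia. Qed.

Lemma strand_period n k : w (n + 2 * (J * M)%N%:Z * k) = w n.
Proof.
rewrite /w shift_period.
by apply: (@trans_eq _ _ _ _ (M%:Z * k) (- (t%:Z * k + a * k))); lia.
Qed.

Lemma strand_dart_period n k : e (n + 2 * (J * M)%N%:Z * k) = e n.
Proof.
rewrite /e strand_period addrAC !shift_period.
by rewrite (inj_eq (addIr _)).
Qed.

Lemma tail_strand_dart n : tail (e n) = tail (w n).
Proof. by rewrite /e; case: ifP => _; rewrite ?tail_rot. Qed.

Lemma strand_step n : w (n + 1) = if f (n + 1) == f n then T 0 1 (w n) else T (-1) 1 (w n).
Proof.
rewrite {1}/w; case: eqP => [->|ne]; rewrite rotD ?addr0 //.
by have [//|->] := fS n.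
Qed.

Lemma head_strand_dart n : head (e n) = tail (w (n + 1)).
Proof. by rewrite /e strand_step; case: ifP => _; [apply: head_rot | apply: head_rot2]. Qed.

(** The reversed edge descends from row [n + 1] to row [n]; the half turn reads this as an ascent
    from row [- n - 1] to row [- n]. *)
Lemma opp_strand_dart n : opp P (e n) = e (- n - 1).
Proof.
have e1 : - n - 1 = - (n + 1) by lia.
rewrite /e subrK e1 strandN !fN eqr_opp strand_step (eq_sym (f n)).
by case: ifP => _; [apply: opp_rot_trans | apply: opp_rot2_trans].
Qed.

(** An edge between strand vertices leaves in one of three directions. Unless it is a strand edge,
    it ends one horizontal unit beside a point of the strand, against [strand_parity]. *)
Lemma strand_adjacent d n m : tail d = tail (w n) -> head d = tail (w m) ->
  exists k, d = e k.
Proof.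
move=> td hd.
have [z hz dz] := tail_dart_cases deg36 td.
have {n td hz} [n zn] : exists n', z = w n'.
  by case: hz => ->; [exists n | exists (- n); rewrite strandN].
have odd1 s : s = 1 \/ s = -1 -> forall i j, T s 0 (w i) <> w j.
  by move=> hs i j /strand_parity[h]; lia.
have onS x y : tail (T x y z) = tail (w m) -> exists k, T x y z = w k.
  by apply: strand_tail; rewrite zn !class_translate.
exists n; move: hd; rewrite /e; case: dz => ->.
- rewrite (head_tail_trans10 z) => /onS[k]; rewrite zn.
  by move/odd1; case; left.
- rewrite head_rot => /onS[k hk]; rewrite -zn; case: eqP => // fn.
  have [//|f1] := fS n.
  have /odd1 [] : T 1 0 (w (n + 1)) = w k by rewrite -hk zn !rotD f1; apply: T_congr; lia.
  by left.
- rewrite head_rot2 // => /onS[k hk]; rewrite -zn; case: eqP => // fn.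
  have /odd1 [] : T (-1) 0 (w (n + 1)) = w k by rewrite -hk zn !rotD fn; apply: T_congr; lia.
  by right.
Qed.

Definition strand_set : {set {set P}} := [set tail (w n%:Z) | n : 'I_(J * M).+1].

Lemma strand_reduce n : exists (r : nat) k, (r <= J * M)%N /\
  (n = r%:Z + 2 * (J * M)%N%:Z * k \/ n = - r%:Z + 2 * (J * M)%N%:Z * k).
Proof.
set L := (J * M)%N; have L0 : (0 < L)%N by rewrite muln_gt0 J_gt0; case: (M) oddM.
have := divz_eq n (2 * L%:Z).
have : 0 <= (n %% (2 * L%:Z))%Z by apply: modz_ge0; lia.
have : (n %% (2 * L%:Z))%Z < 2 * L%:Z by apply: ltz_pmod; lia.
move: (_ %/ _)%Z (_ %% _)%Z => q [r|r] // r1 _ ->.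
have [rL|rL] := leqP r L; first by exists r, q; split=> //; left; lia.
by exists (2 * L - r)%N, (q + 1); split; [lia | right; lia].
Qed.

Lemma strand_in n : tail (w n) \in strand_set.
Proof.
have [r [k [rL nE]]] := strand_reduce n.
apply/imsetP; exists (Ordinal (rL : (r < (J * M).+1)%N)) => //=.
by case: nE => ->; rewrite strand_period // strandN tail_rotX.
Qed.

Lemma strand_induces : induces_path strand_set.
Proof.
pose L := (J * M)%N; pose W (n : nat) := tail (w n%:Z).
have L0 : (0 < L)%N by rewrite muln_gt0 J_gt0; case: (M) oddM.
exists L, (W 0%N), (mkseq (fun n => e n%:Z) L).
set p := mkseq _ _.
have tp : map (@tail P) p = mkseq W L.
  by rewrite /p /mkseq -map_comp; apply: eq_map => n /=; apply: tail_strand_dart.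
have hp : map (@head P) p = mkseq (fun n => W n.+1) L.
  rewrite /p /mkseq -map_comp; apply: eq_map => n /=.
  by rewrite head_strand_dart /W -addn1 PoszD.
have Wp : W 0%N :: map (@head P) p = mkseq W L.+1 by rewrite hp mkseq_shift.
have SE : strand_set = [set v in W 0%N :: map (@head P) p].
  apply/setP => v; rewrite inE Wp; apply/imsetP/mapP => [[i _ ->]|[i]].
    by exists (i : nat); rewrite ?mem_iota ?ltn_ord.
  by rewrite mem_iota => /= iL ->; exists (Ordinal iL).
split; first split.
- exact: tail_in_vertices.
- by rewrite tp hp belast_mkseq.
- rewrite Wp map_inj_in_uniq ?iota_uniq // => n m.
  (* Equal tails make [n - m] or [n + m] a multiple of [2 * L]; for indices from 0 to [L], a sum 0
     or [2 * L] again forces [n = m]. *)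
  rewrite !mem_iota /= => nL mL /strand_tail_eq[] /strand_inj[k]; rewrite -/L => nm.
    have k0 : k = 0 by nia.
    by rewrite k0 in nm; lia.
  have [k0|k1] : k = 0 \/ k = 1 by nia.
    by rewrite k0 in nm; lia.
  by rewrite k1 in nm; lia.
- exact: SE.
- exact: size_mkseq.
move=> d /imsetP[n _ td] /imsetP[m _ hd]; split=> // _.
have [n' ->] := strand_adjacent td hd.
have epos (r : nat) : (r < L)%N -> e r%:Z \in p by move=> rL; apply: map_f; rewrite mem_iota.
(* Modulo [2 * L], the indices 0 to [L - 1] give the darts of the path and the indices [- L] to
   [- 1] their reversals. *)
have [r [k [rL nE]]] := strand_reduce n'.
case: nE => nE.
  have [rL'|Lr] := ltnP r L; first by left; rewrite nE strand_dart_period epos.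
  right; rewrite opp_strand_dart.
  have -> : - n' - 1 = L.-1%:Z + 2 * L%:Z * (- k - 1) by lia.
  by rewrite strand_dart_period epos // prednK.
have [r0|r0] := posnP r.
  by left; rewrite nE strand_dart_period r0 epos.
right; rewrite opp_strand_dart.
have -> : - n' - 1 = r.-1%:Z + 2 * L%:Z * (- k) by lia.
by rewrite strand_dart_period epos //; lia.
Qed.

End Base.

Section Cover.
Variable b : P.
Hypotheses (Rb : R b = b) (latb : lattice_at b).
Let b' := T M%:Z 0 b.

Lemma strand_shifted n : strand b' n = T M%:Z 0 (strand b n).
Proof. by rewrite /strand !rotD addrC [0 + n]addrC. Qed.

Lemma half_turn_shifted : R b' = b'.
Proof.
rewrite /b' -rotN Rb; apply: (trans_eq latb (k := 0) (l := -1)); lia.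
Qed.

Lemma lattice_shifted : lattice_at b'.
Proof.
move=> x y; rewrite -latb /b' rotD [_ + x]addrC [0 + y]addrC -rotD.
by split=> [/perm_inj|->].
Qed.

Lemma strands_disjoint : [disjoint strand_set b & strand_set b'].
Proof.
rewrite -setI_eq0; apply/eqP/setP => v; rewrite !inE.
apply/negP => /andP[/imsetP[n _ ->] /imsetP[m _]].
rewrite strand_shifted => tnm.
have [k] : exists k, T M%:Z 0 (strand b m) = strand b k.
  by apply: (strand_tail Rb (n := n)); rewrite ?tnm // !class_translate.
by case/strand_parity => // h; lia.
Qed.

(** Relative to Lambda, [2 * J] rows move the strand by [2 * (a + t)], which generates the even
    residues modulo [2 * M]; so the strand meets row [y] in every point with the parity of [f y]. As
    [M] is odd, the shifted strand takes the other parity. *)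
Lemma strands_cover x y :
  tail (T x y b) \in strand_set b :|: strand_set b'.
Proof.
have [[u v] /= uv] := coprimezP _ _ coprime_at.
have hit s h : x - s - f y = 2 * h -> exists n, T x y b = T s 0 (strand b n).
  move=> xE; exists (y + 2 * J%:Z * (- (u * h))).
  rewrite rotD fD; apply: (trans_eq latb (k := u * h) (l := v * h)); first lia.
  have -> : x = 2 * (h * 1) + s + f y by lia.
  by rewrite -uv; lia.
have [h [xy|xy]] : exists h, x - 0 - f y = 2 * h \/ x - M%:Z - f y = 2 * h.
  have [k [xE|xE]] : exists k, x - f y = 2 * k \/ x - f y = 2 * k + 1.
    by exists ((x - f y) %/ 2)%Z; lia.
  - by exists k; left; lia.
  - by exists (k - M./2%:Z); right; lia.
- have [n ->] := hit _ _ xy; rewrite trans0_act inE strand_in //.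
- have [n ->] := hit _ _ xy; rewrite -strand_shifted inE orbC strand_in //.
    exact: half_turn_shifted.
  exact: lattice_shifted.
Qed.

End Cover.

End Strand.

(** * From the two maximal paths to the lattice *)

Section Axes.
Variables (P : cmap) (c : P -> 'Z_3).
Hypothesis deg36 : forall v, v \in vertices P -> #|v| = 3 \/ #|v| = 6.
Hypothesis tri : triangulated P.
Hypothesis hc : edge_classes c.

Local Notation R := (rot P ^+ 3)%g.
Local Notation T i j := (trans (opp P) (rot P) i%R j%R).
Let rotD := transD_act deg36 tri.
Let rotN := transN_act deg36.

Section Component.
Variables (q : 'Z_3) (u : {set P}).
Local Notation F := [pred d | c d == q].
Let A := [set v in vertices P | connect (adj F) u v].

Lemma adj_sym : symmetric (adj F).
Proof.
suff sub v w : adj F v w -> adj F w v by move=> v w; apply/idP/idP; apply: sub.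
case/existsP => d /and3P[/= Fd tv hw]; apply/existsP; exists (opp P d).
by rewrite /= hc.1 Fd hw /head opp_invol.
Qed.

Lemma component_head d : c d = q -> tail d \in A -> head d \in A.
Proof.
rewrite !inE tail_in_vertices => cd /= ud; rewrite tail_in_vertices /=.
apply: connect_trans ud (connect1 _); apply/existsP; exists d.
by rewrite /= cd !eqxx.
Qed.

Lemma component_trans d x : c d = q -> tail d \in A -> tail (T x 0 d) \in A.
Proof.
move=> cd td.
have step e : c e = q -> tail e \in A -> tail (T 1 0 e) \in A /\ tail (T (-1) 0 e) \in A.
  move=> ce te; split.
    by rewrite -(head_tail_trans10 e); apply: component_head.
  have -> : T (-1) 0 e = opp P (R e).
    by rewrite (opp_trans deg36) -rotN (half_turn_invol deg36) oppr0.
  by apply: component_head; rewrite ?tail_rotX ?class_half_turn.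
elim/int_ind: x => [|n IHn|n IHn]; first by rewrite trans0_act.
  have [+ _] := step _ (etrans (class_translate hc _ _ _) cd) IHn.
  by rewrite rotD addr0 -addn1 PoszD.
have [_] := step _ (etrans (class_translate hc _ _ _) cd) IHn.
have -> : (- n.+1%:Z = - n%:Z + -1)%R by lia.
by rewrite rotD addr0.
Qed.

End Component.

Lemma component_eq q u1 u2 v :
  let comp u := [set v in vertices P | connect (adj [pred d | c d == q]) u v] in
  v \in comp u1 -> v \in comp u2 -> comp u1 = comp u2.
Proof.
move=> comp; rewrite !inE => /andP[_ c1] /andP[_ c2]; apply/setP => w; rewrite !inE.
have sym := sym_connect_sym (adj_sym q).
by rewrite (same_connect sym c1) (same_connect sym c2).
Qed.

(** From the first dart of the path, [X] walks straight along the path, turns back at its end, and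
    returns after exactly [2 * n] steps. *)
Lemma maximal_path_axis q A n : (0 < n)%N -> maximal_path c q A n ->
  exists d, [/\ c d = q, tail d \in A, R d = d,
    T (2 * n%:Z) 0 d = d & forall m : nat, (0 < m < 2 * n)%N -> T m%:Z 0 d <> d].
Proof.
move=> n0 [[u0 u0v ->] [u [p [[uv tp up AE sp] Ap]]]].
set A' := [set v in vertices P | _] in AE Ap *.
case: p => [|d p'] in tp up AE sp Ap *; first by rewrite -sp in n0.
set p := d :: p' in tp up AE sp Ap *.
pose V i := nth u (u :: map (@head P) p) i; pose e i := nth d p i.
have size_heads : size (map (@head P) p) = n by rewrite size_map.
have size_vs : size (u :: map (@head P) p) = n.+1 by rewrite -size_heads.
have te i : i < n -> tail (e i) = V i.
  move=> lin; rewrite -(nth_map d u) ?sp // tp /V (lastI u) nth_rcons.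
  by rewrite size_belast size_heads lin.
have he i : i < n -> head (e i) = V i.+1.
  by move=> lin; rewrite /V -[RHS]/(nth u (map (@head P) p) i) (nth_map d) ?sp.
have Vinj i j : i <= n -> j <= n -> V i = V j -> i = j.
  by move=> iin jn /eqP; rewrite /V nth_uniq ?up ?size_vs ?ltnS // => /eqP.
have VA i : i <= n -> V i \in A'.
  by move=> iin; rewrite AE inE mem_nth // size_vs.
have ce i : i < n -> c (e i) = q.
  move=> lin; have tA : tail (e i) \in A' by rewrite te // VA // ltnW.
  have hA : head (e i) \in A' by rewrite he // VA.
  by have [_ /(_ (or_introl (mem_nth _ _)))] := Ap _ tA hA; rewrite sp => /(_ lin)/eqP.
(* [A'] is a whole component, so each class [q] dart leaving a path vertex runs along the path,
   forwards or backwards. *)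
have along z i : c z = q -> i <= n -> tail z = V i ->
    (i < n /\ z = e i) \/ (0 < i /\ opp P z = e i.-1).
  move=> cz iin tz.
  have tA : tail z \in A' by rewrite tz VA.
  have [+ _] := Ap z tA (component_head cz tA).
  rewrite /= cz eqxx => /(_ isT)[] /(nthP d)[j]; rewrite sp => jn ej.
    left; have ji : i = j by apply: Vinj; rewrite // ?(ltnW jn) // -tz -ej te.
    by rewrite ji.
  right; have ji : i = j.+1.
    by apply: Vinj; rewrite // -he // /e ej /head opp_invol.
  by rewrite ji.
have Rd : R d = d.
  have [||[_ ->]//|[]//] := along (R d) 0 _ isT.
    by rewrite class_half_turn // (ce 0).
  by rewrite tail_rotX -(te 0).
have R_opp i : i < n -> opp P (T 1 0 (e i)) = e i -> R (opp P (e i)) = opp P (e i).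
  move=> lin E; rewrite -{2}E opp_invol (opp_trans deg36 (e i)).
  by rewrite (half_turn_invol deg36).
have cT i : i < n -> c (T 1 0 (e i)) = q by move=> lin; rewrite class_translate // ce.
have tT i : i < n -> tail (T 1 0 (e i)) = V i.+1.
  by move=> lin; rewrite -he // (head_tail_trans10 (e i)).
have Te i : i < n -> e i = T i%:Z 0 d.
  elim: i => [|i IHi] lin; first by rewrite trans0_act.
  have lin' := ltnW lin.
  rewrite -addn1 PoszD -[0%R]addr0 -rotD -IHi // addn1.
  have [[_ //]|[_ /= /(R_opp _ lin') RE]] := along _ _ (cT _ lin') lin' (tT _ lin').
  (* If [X] turned back at an inner vertex, that vertex would have a single dart of class [q], and
     the next path dart would retrace the last one. *)
  exfalso; have : e i.+1 = opp P (e i).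
    have [||//|] := tail_class_eq (d := e i.+1) (e := opp P (e i)) deg36 hc.
    - by rewrite te // -he.
    - by rewrite hc.1 !ce.
    by rewrite RE.
  move/(congr1 (@head P)); rewrite he // /head opp_invol te //.
  by move/(Vinj _ _ lin (ltnW lin')); lia.
have TV i : i <= n -> tail (T i%:Z 0 d) = V i.
  case: i => [|i] lin; first by rewrite trans0_act -(te 0).
  by rewrite -tT // (Te i) // rotD addr0 -PoszD addn1.
have Rend : R (T n%:Z 0 d) = T n%:Z 0 d.
  have nE : n = n.-1.+1 by rewrite prednK.
  have lin : n.-1 < n by rewrite -nE.
  have -> : T n%:Z 0 d = T 1 0 (e n.-1).
    by rewrite (Te n.-1) // rotD addr0 -PoszD addn1 -nE.
  have [[]|[_]] := along _ n (cT _ lin) (leqnn _) (etrans (tT _ lin) (congr1 V (esym nE))).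
    by rewrite ltnn.
  move=> E; have := R_opp _ lin E.
  by have -> : opp P (e n.-1) = T 1 0 (e n.-1) by rewrite -{1}E opp_invol.
(* The half turn fixes both [T n 0 d] and [d]; inserted midway, it makes the second half of the walk
   undo the first. *)
have T2n : T (2 * n%:Z) 0 d = d.
  have -> : T (2 * n%:Z) 0 d = T n%:Z 0 (R (T n%:Z 0 d)).
    by rewrite Rend rotD; congr (fun_of_perm (trans _ _ _ _) _); lia.
  by rewrite -rotN Rd rotD oppr0 addr0 addNr trans0_act.
have small m : 0 < m <= n -> T m%:Z 0 d <> d.
  case/andP=> m0 mn /(congr1 (@tail P)).
  by rewrite TV // -[tail d]/(tail (e 0)) te // => /(Vinj m 0 mn isT) E; rewrite E in m0.
exists d; split=> //.
- exact: (ce 0).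
- by have := VA 0 isT; rewrite -(te 0).
move=> m /andP[m0 m2n].
have [mn|nm] := leqP m n; first by apply: small; rewrite m0.
move=> Tm; apply: (small (2 * n - m)); first by apply/andP; split; lia.
have -> : T (2 * n - m)%N%:Z 0 d = T (- m%:Z) 0 (T (2 * n%:Z) 0 d).
  by rewrite rotD; congr (fun_of_perm (trans _ _ _ _) _); lia.
by rewrite T2n -{1}Tm rotD subrr addr0 trans0_act.
Qed.

Local Open Scope ring_scope.

Lemma stabilizerM b x y k : T x y b = b -> T (x * k) (y * k) b = b.
Proof.
move=> Tb; have Tb' : T (- x) (- y) b = b by rewrite -{1}Tb rotD !subrr trans0_act.
elim/int_ind: k => [|n IHn|n IHn]; first by rewrite !mulr0 trans0_act.
  by rewrite -addn1 PoszD !mulrDr !mulr1 -rotD IHn.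
have -> : - n.+1%:Z = - n%:Z - 1 by lia.
by rewrite !mulrBr !mulr1 -rotD IHn.
Qed.

Lemma stabilizerD b x y x' y' : T x y b = b -> T x' y' b = b -> T (x + x') (y + y') b = b.
Proof. by move=> Tb Tb'; rewrite -rotD Tb. Qed.

Lemma axis_row b (n : nat) x : (0 < n)%N -> T (2 * n%:Z) 0 b = b ->
    (forall m : nat, (0 < m < 2 * n)%N -> T m%:Z 0 b <> b) -> T x 0 b = b ->
  exists l, x = 2 * n%:Z * l.
Proof.
move=> n0 T2n small Tx; exists (x %/ (2 * n%:Z))%Z.
have := divz_eq x (2 * n%:Z).
have : 0 <= (x %% (2 * n%:Z))%Z by apply: modz_ge0; lia.
have : (x %% (2 * n%:Z))%Z < 2 * n%:Z by apply: ltz_pmod; lia.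
move: (_ %/ _)%Z (_ %% _)%Z => q [r|r] // r2 _ xE.
have [r0|r0] := posnP r; first by rewrite xE r0; lia.
case: (small r); first lia.
have -> : r%:Z = x + 2 * n%:Z * (- q) by lia.
have := stabilizerD Tx (stabilizerM (- q) T2n).
by rewrite mul0r addr0.
Qed.

(** Let [N] be the least positive height of a lattice vector. The half turn fixes [b] and [d1], so
    twice the vector from [b] to [d1] is in Lambda. Its height is an odd multiple of [N], since an
    even one would put [d1] in row 0; hence [N = 2 * J], and [d1] has a representative at height
    [J]. *)
Lemma two_axes_lattice b d1 (M : nat) : (0 < M)%N -> T (2 * M%:Z) 0 b = b ->
    (forall m : nat, (0 < m < 2 * M)%N -> T m%:Z 0 b <> b) -> R b = b -> R d1 = d1 ->
    (exists x y, d1 = T x y b) -> (forall x, d1 <> T x 0 b) ->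
  exists (a : int) (J : nat), [/\ (0 < J)%N, d1 = T a J%:Z b & lattice_at J M a b].
Proof.
move=> M0 T2M small Rb Rd1 [x1 [y1 d1E]] d1_off.
(* Horizontal coordinates matter only modulo [2 * M], which makes the condition on a row
   decidable. *)
pose hit (j : nat) := (0 < j)%N && [exists i : 'I_(2 * M), T i%:Z j%:Z b == b].
have hitI (j : nat) x : (0 < j)%N -> T x j%:Z b = b -> hit j.
  move=> j0 Tx; rewrite /hit j0; apply/existsP.
  have := divz_eq x (2 * M%:Z).
  have : 0 <= (x %% (2 * M%:Z))%Z by apply: modz_ge0; lia.
  have : (x %% (2 * M%:Z))%Z < 2 * M%:Z by apply: ltz_pmod; lia.
  move: (_ %/ _)%Z (_ %% _)%Z => q [r|r] // r2 _ xE.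
  have rM : (r < 2 * M)%N by lia.
  exists (Ordinal rM); apply/eqP => /=.
  have -> : r%:Z = x + 2 * M%:Z * (- q) by lia.
  by have := stabilizerD Tx (stabilizerM (- q) T2M); rewrite mul0r addr0.
have ex_hit : exists j, hit j.
  exists #[T 0 1]%g; apply: (hitI _ 0); first exact: order_gt0.
  have -> : T 0 #[T 0 1]%g%:Z = (T 0 1 ^+ #[T 0 1]%g)%g.
    by rewrite {1}/trans trans01 mul1g.
  by rewrite expg_order perm1.
have [N /andP[N0 /existsP[a0 /eqP Ta0]] Nmin] := ex_minnP ex_hit.
have rows x y : T x y b = b -> exists k, y = N%:Z * k /\ T (x - a0%:Z * k) 0 b = b.
  move=> Txy; exists (y %/ N%:Z)%Z.
  have := divz_eq y N%:Z.
  have : 0 <= (y %% N%:Z)%Z by apply: modz_ge0; lia.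
  have : (y %% N%:Z)%Z < N%:Z by apply: ltz_pmod; lia.
  move: (_ %/ _)%Z (_ %% _)%Z => q [r|r] // r2 _ yE.
  have := stabilizerD Txy (stabilizerM (- q) Ta0).
  have -> : y + N%:Z * (- q) = r by lia.
  have [r0|r0 Tr] := posnP r.
    by rewrite r0 mulrN => ->; split=> //; lia.
  by have := Nmin _ (hitI _ _ r0 Tr); lia.
have fixed2 x y : d1 = T x y b -> T (2 * x) (2 * y) b = b.
  move=> E; have : T (- x) (- y) b = T x y b by rewrite -{1}Rb rotN -E.
  move/(congr1 (T x y)); rewrite !rotD !addNr trans0_act => {2}->.
  by congr (fun_of_perm (trans _ _ _ _) _); lia.
have [q [y1E _]] := rows _ _ (fixed2 _ _ d1E).
have [h [qE|qE]] : exists h, q = 2 * h \/ q = 2 * h + 1 by exists (q %/ 2)%Z; lia.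
  case: (d1_off (x1 + a0%:Z * (- h))).
  rewrite d1E -{1}(stabilizerM (- h) Ta0) rotD.
  by congr (fun_of_perm (trans _ _ _ _) _); lia.
pose J := N./2.
have NJ : N = (2 * J)%N.
  have : ~~ odd N by apply/negP => oN; have := odd_double_half N; rewrite oN; nia.
  by move=> eN; rewrite -(odd_double_half N) (negPf eN); lia.
pose a := x1 + a0%:Z * (- h).
have d1J : d1 = T a J%:Z b.
  rewrite d1E -{1}(stabilizerM (- h) Ta0) rotD.
  by congr (fun_of_perm (trans _ _ _ _) _); rewrite /a; nia.
exists a, J; split=> //; first lia.
have Ta := fixed2 _ _ d1J.
move=> x y; split=> [Txy|[k [l [-> ->]]]].
  have [k [yE _]] := rows _ _ Txy; exists k.
  have : T (x - 2 * a * k) 0 b = b.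
    have := stabilizerD Txy (stabilizerM (- k) Ta).
    rewrite mulrN; have -> : y + 2 * J%:Z * - k = 0 by lia.
    by [].
  by case/(axis_row M0 T2M small) => l xE; exists l; split; lia.
have := stabilizerD (stabilizerM k Ta) (stabilizerM l T2M).
by rewrite mul0r addr0.
Qed.

Lemma tail_of_class b v : v \in vertices P -> exists2 d, v = tail d & c d = c b.
Proof.
case/vertexP=> d ->; exists ((rot P ^+ (c b - c d)%R)%g d); first by rewrite tail_rotX.
by rewrite class_rotX // natr_Zp addrC subrK.
Qed.

Lemma path_up b (J : nat) :
  let W (n : nat) := tail (T 0 n%:Z b) in
  let s := mkseq (fun n => W n.+1) J in
  path (adj predT) (W 0%N) s /\ last (W 0%N) s = W J.
Proof.
move=> W s; split.
  apply/(pathP (W 0%N)) => i; rewrite size_mkseq => iJ.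
  rewrite mkseq_shift !nth_mkseq //; last exact: ltnW.
  apply/existsP; exists (rot P (T 0 i%:Z b)).
  by rewrite /= tail_rot eqxx head_rot rotD addr0 -PoszD addn1 eqxx.
by rewrite -[LHS]/(last (W 0%N) (W 0%N :: s)) mkseq_shift -nth_last size_mkseq nth_mkseq.
Qed.

End Axes.

(** * Assembling the partition into two induced paths *)

Theorem theorem6p2 (P : cmap) (c : P -> 'Z_3)
    (hP : calP P) (hc : edge_classes c) :
  (exists (q : 'Z_3) (M K : nat),
     [/\ class_MK c q M K, odd M & M <= 3 * K]) ->
  exists S T : {set {set P}},
    [/\ S :|: T = vertices P, [disjoint S & T],
        induces_path S & induces_path T].
Proof.
case: hP => _ [_ conn _] _ tri deg36 [q [M [K [[A [B [AB mA mB [_ dist]]]] oM MK]]]].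
have M0 : 0 < M by case: (M) oM.
have [b [cb bA Rb T2M small]] := maximal_path_axis deg36 tri hc M0 mA.
have [d1 [cd1 d1B Rd1 _ _]] := maximal_path_axis deg36 tri hc M0 mB.
have [[[u1 _ AE] _] [[u2 _ BE] _]] := (mA, mB).
(* Row 0 stays inside the component [A], so [d1] on it would force [A = B]. *)
have d1_off x : d1 <> trans (opp P) (rot P) x 0%R b.
  move=> d1E; case/eqP: AB; rewrite AE BE; apply: (component_eq hc (v := tail d1)).
    by rewrite d1E; apply: component_trans; rewrite -?AE.
  by rewrite -BE.
have ex1 : exists x y, d1 = trans (opp P) (rot P) x y b.
  by apply: (dart_of_class deg36 tri hc); rewrite ?cd1.
have [a [J [J0 d1J lat]]] := two_axes_lattice deg36 tri M0 T2M small Rb Rd1 ex1 d1_off.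
(* The vertical walk of [J] edges from [b] ends in the row of [d1], hence on [B]. *)
have KJ : K <= J.
  have [pup lup] := path_up deg36 tri b J.
  have /= := dist _ _ _ pup; rewrite size_mkseq; apply; first by rewrite trans0_act.
  rewrite lup BE.
  have -> : trans (opp P) (rot P) 0%R J b = trans (opp P) (rot P) (- a)%R 0%R d1.
    by rewrite d1J transD_act // subrr addr0.
  by apply: component_trans; rewrite -?BE.
have [t tJ cop] := coprime_in_window a oM (leq_trans MK (leq_mul (leqnn 3) KJ)).
have [f [fN fD fS]] := shift_exists J0 tJ.
(* The second strand starts at the other end of [A], reached from [b] by the [M] edges of the
   path. *)
pose b' := trans (opp P) (rot P) M%:Z 0%R b.
exists (strand_set J M f b), (strand_set J M f b'); split.
- apply/eqP; rewrite eqEsubset; apply/andP; split; apply/subsetP => v.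
    by case/setUP=> /imsetP[n _ ->]; apply: tail_in_vertices.
  case/(tail_of_class hc b) => d -> cd.
  have [x [y ->]] := dart_of_class deg36 tri hc Rb conn cd.
  exact: (strands_cover deg36 tri J0 oM cop fN fD).
- exact: (strands_disjoint deg36 tri hc J0 oM cop fN fD).
- exact: (strand_induces deg36 tri hc J0 oM cop).
apply: (strand_induces deg36 tri hc J0 oM cop) => //.
  exact: (half_turn_shifted deg36 tri J0 oM cop Rb lat).
exact: (lattice_shifted deg36 tri lat).
Qed.
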